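(* Let $n=2$, $m=1$, $A:=\begin{pmatrix}1&0\\0&-1\end{pmatrix}$, $Q:=\begin{pmatrix}4&0\\0&4\end{pmatrix}$, $f:=\begin{pmatrix}\sqrt{27}\\1\end{pmatrix}$, $b:=\begin{pmatrix}0\\0\end{pmatrix}$, $c:=52$, and $D:=\tfrac12Q$, so that $D$ is symmetric positive definite with $D^TD=D^2=Q$. Then the following two conditions hold: ($C_1$) $A+Q$ is positive definite; ($C_2$) $Q$ is positive definite, $A+Q$ is positive definite, and $\|DA^{-1}f\|>\|b^TD^{-1}\|+\sqrt{\|b^TD^{-1}\|^2+2|c|}$, where $\|\cdot\|$ is the Euclidean norm. Nevertheless, the dual problem $\max_{\sigma\in\mathcal{Y}}P^d(\sigma)$ (defined in the context) for these data, with $Q_1=Q$, $b_1=b$, $c_1=c$, has no solution belonging to the set $\mathcal{S}_+$. In particular, it is false that conditions $(C_1)$ and $(C_2)$ imply that this dual problem has a unique nonzero solution in $\mathcal{S}_+$.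
   Context: General setting. Given a symmetric matrix $A\in\mathbb{R}^{n\times n}$, a vector $f\in\mathbb{R}^n$, symmetric matrices $Q_i\in\mathbb{R}^{n\times n}$, vectors $b_i\in\mathbb{R}^n$ and reals $c_i$ ($i=1,\dots,m$), let $\mathcal{X}_a=\{x\in\mathbb{R}^n\mid \tfrac12x^TQ_ix+b_i^Tx\le c_i,\ i=1,\dots,m\}$. For $\sigma\in\mathbb{R}^m$ put $G(\sigma)=A+\sum_{i=1}^m\sigma_iQ_i$, $F(\sigma)=f-\sum_{i=1}^m\sigma_ib_i$, $c=(c_1,\dots,c_m)^T$. Let $\mathcal{S}=\{\sigma\in\mathbb{R}^m\mid\sigma\ge0\text{ (componentwise)},\ \det G(\sigma)\ne0\}$, let $\mathcal{S}_+=\{\sigma\in\mathcal{S}\mid G(\sigma)\text{ is positive definite}\}$, and for $\sigma\in\mathcal{S}$ let $P^d(\sigma)=-\tfrac12F(\sigma)^TG(\sigma)^{-1}F(\sigma)-c^T\sigma$. Let $\mathcal{Y}=\{\sigma\in\mathcal{S}\mid G(\sigma)^{-1}F(\sigma)\in\mathcal{X}_a\}$. The dual problem is $\max_{\sigma\in\mathcal{Y}}P^d(\sigma)$; a solution of it is a point of $\mathcal{Y}$ at which $P^d$ attains its global maximum over $\mathcal{Y}$. *)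

(* Defs.v *)
From HB Require Import structures.
From mathcomp Require Import all_boot all_order all_algebra.
From mathcomp Require Import classical_sets reals.

Set Implicit Arguments.
Unset Strict Implicit.
Unset Printing Implicit Defensive.

Import Order.TTheory GRing.Theory Num.Theory.
Local Open Scope ring_scope.
Local Open Scope classical_set_scope.

(* Explicit m x n matrix from the list of its rows; missing entries are 0. *)
Definition mx_of_rows (R : realType) (m n : nat) (rows : seq (seq R)) :
    'M[R]_(m, n) :=
  \matrix_(i < m, j < n) (nth [::] rows i)`_j.

Definition posdef (R : realType) (n : nat) (M : 'M[R]_n) : Prop :=
  M^T = M /\ forall x : 'cV[R]_n, x != 0 -> 0 < (x^T *m M *m x) 0 0.

(* Used only at n = 1 and m = 1, i.e. on column and on row vectors. *)
Definition euclid_norm (R : realType) (m n : nat) (v : 'M[R]_(m, n)) : R :=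
  Num.sqrt (\sum_i \sum_j v i j ^+ 2).

Section Problem.
Variables (R : realType) (n m : nat).
Variables (A : 'M[R]_n) (f : 'cV[R]_n).
Variables (Q : 'I_m -> 'M[R]_n) (b : 'I_m -> 'cV[R]_n) (c : 'cV[R]_m).

Definition Xa : set 'cV[R]_n :=
  [set x : 'cV[R]_n | forall i : 'I_m,
    2^-1 * (x^T *m Q i *m x) 0 0 + ((b i)^T *m x) 0 0 <= c i 0].

Definition G (s : 'cV[R]_m) : 'M[R]_n := A + \sum_(i < m) s i 0 *: Q i.

Definition F (s : 'cV[R]_m) : 'cV[R]_n := f - \sum_(i < m) s i 0 *: b i.

Definition dualS : set 'cV[R]_m :=
  [set s : 'cV[R]_m | (forall i : 'I_m, 0 <= s i 0) /\ \det (G s) != 0].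

Definition dualSplus : set 'cV[R]_m := [set s : 'cV[R]_m | dualS s /\ posdef (G s)].

(* Meaningful on dualS only: invmx M is M itself when M is singular. *)
Definition Pd (s : 'cV[R]_m) : R :=
  - (2^-1 * ((F s)^T *m invmx (G s) *m F s) 0 0) - (c^T *m s) 0 0.

Definition dualY : set 'cV[R]_m :=
  [set s : 'cV[R]_m | dualS s /\ Xa (invmx (G s) *m F s)].

Definition dual_solution (s : 'cV[R]_m) : Prop :=
  dualY s /\ forall t : 'cV[R]_m, dualY t -> Pd t <= Pd s.

End Problem.

Definition condC1 (R : realType) (n : nat) (A Q : 'M[R]_n) : Prop :=
  posdef (A + Q).

(* The unitmx conjuncts record that the inverses in the inequality exist, as
   invmx is total. *)
Definition condC2 (R : realType) (n : nat) (A Q D : 'M[R]_n)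
    (f b : 'cV[R]_n) (c : R) : Prop :=
  [/\ posdef Q, posdef (A + Q), A \in unitmx, D \in unitmx &
      euclid_norm (D *m invmx A *m f) >
        euclid_norm (b^T *m invmx D) +
        Num.sqrt (euclid_norm (b^T *m invmx D) ^+ 2 + 2 * `|c|)].

(* Main.v *)
Require Import Defs.
From HB Require Import structures.
From mathcomp Require Import all_boot all_order all_algebra.
From mathcomp Require Import classical_sets reals.
From mathcomp Require Import ring lra.

(** There is a single multiplier and all the matrices are diagonal, so the dual
    is an explicit function of one real variable.  With [u = 4 s], [G s] is
    the diagonal matrix with entries [u + 1] and [u - 1], and
    [[
      P^d(s) = - (27 / (u + 1) + 1 / (u - 1)) / 2 - 13 u,
    ]]
    so [G s] is positive definite exactly when [1 < u].  There the term
    [1 / (u - 1)] is positive, and [P^d < - 29 / 2] follows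
    ([dual_value_lt_on_posdef]).  On the other side of the pole [u = 1] that
    term changes sign: at [u = 1 / 2], where [G s] is indefinite, the dual value
    is [- 29 / 2].  This point is dual feasible, since the constraint reads
    [27 / (u + 1)^2 + 1 / (u - 1)^2 <= 26] and the left-hand side is [16].
    Hence no point of S_+ maximizes P^d over Y.

    Condition C_2 is the inequality [sqrt 104 < sqrt 112]: the left-hand side is
    [sqrt (2 c)] because [b = 0], and [D A^-1 f = (2 sqrt 27, -2)]. *)

Set Implicit Arguments.
Unset Strict Implicit.
Unset Printing Implicit Defensive.

Import Order.TTheory GRing.Theory Num.Theory.
Local Open Scope ring_scope.
Local Open Scope classical_set_scope.

Local Notation diag2 a d := (mx_of_rows 2 2 [:: [:: a; 0]; [:: 0; d]]).
Local Notation col2 x y := (mx_of_rows 2 1 [:: [:: x]; [:: y]]).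

Section PlaneDiagonal.
Variable R : realType.
Implicit Types (a d x y k : R).

Lemma ord2P (P : 'I_2 -> Prop) : P 0 -> P 1 -> forall i, P i.
Proof.
move=> P0 P1; case=> [[|[|//]] lti].
- by rewrite (_ : Ordinal lti = 0) //; apply/val_inj.
- by rewrite (_ : Ordinal lti = 1) //; apply/val_inj.
Qed.

Lemma eq_mx2 (M N : 'M[R]_2) : M 0 0 = N 0 0 -> M 0 1 = N 0 1 ->
  M 1 0 = N 1 0 -> M 1 1 = N 1 1 -> M = N.
Proof. by move=> *; apply/matrixP; apply: ord2P; apply: ord2P. Qed.

Lemma eq_col2 (v w : 'cV[R]_2) : v 0 0 = w 0 0 -> v 1 0 = w 1 0 -> v = w.
Proof.
by move=> *; apply/matrixP=> i j; rewrite (ord1 j); move: i; apply: ord2P.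
Qed.

Lemma diag2D a d a' d' :
  diag2 a d + diag2 a' d' = diag2 (a + a') (d + d') :> 'M[R]_2.
Proof. by apply: eq_mx2; rewrite !mxE /= ?addr0. Qed.

Lemma diag2Z k a d : k *: diag2 a d = diag2 (k * a) (k * d) :> 'M[R]_2.
Proof. by apply: eq_mx2; rewrite !mxE /= ?mulr0. Qed.

Lemma diag2M a d a' d' :
  diag2 a d *m diag2 a' d' = diag2 (a * a') (d * d') :> 'M[R]_2.
Proof.
by apply: eq_mx2; rewrite !mxE !big_ord_recl big_ord0 !mxE /=
  ?(mulr0, mul0r, addr0, add0r).
Qed.

Lemma tr_diag2 a d : (diag2 a d)^T = diag2 a d :> 'M[R]_2.
Proof. by apply: eq_mx2; rewrite !mxE. Qed.

Lemma diag2_col2 a d x y :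
  diag2 a d *m col2 x y = col2 (a * x) (d * y) :> 'cV[R]_2.
Proof.
by apply: eq_col2; rewrite !mxE !big_ord_recl big_ord0 !mxE /=
  ?(mulr0, mul0r, addr0, add0r).
Qed.

Lemma col2_dot x y x' y' :
  ((col2 x y : 'cV[R]_2)^T *m (col2 x' y' : 'cV[R]_2)) 0 0 = x * x' + y * y'.
Proof. by rewrite !mxE !big_ord_recl big_ord0 !mxE /= addr0. Qed.

Lemma det_diag2 a d : \det (diag2 a d : 'M[R]_2) = a * d.
Proof.
have -> : diag2 a d = diag_mx (\row_i (col2 a d : 'cV[R]_2) i 0) :> 'M[R]_2.
  by apply: eq_mx2; rewrite !mxE.
by rewrite det_diag !big_ord_recl big_ord0 !mxE /= mulr1.
Qed.

Lemma unit_diag2 a d :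
  a != 0 -> d != 0 -> (diag2 a d : 'M[R]_2) \in unitmx.
Proof. by move=> a0 d0; rewrite unitmxE det_diag2 unitfE mulf_neq0. Qed.

Lemma inv_diag2 a d : a != 0 -> d != 0 ->
  invmx (diag2 a d) = diag2 a^-1 d^-1 :> 'M[R]_2.
Proof.
move=> a0 d0; rewrite -[RHS](mulKmx (unit_diag2 a0 d0)) diag2M !mulfV //.
suff -> : diag2 1 1 = 1%:M :> 'M[R]_2 by rewrite mulmx1.
by apply: eq_mx2; rewrite !mxE.
Qed.

Lemma col2_eta (v : 'cV[R]_2) : v = col2 (v 0 0) (v 1 0).
Proof. by apply: eq_col2; rewrite !mxE. Qed.

Lemma quad_diag2 a d (v : 'cV[R]_2) :
  (v^T *m diag2 a d *m v) 0 0 = a * v 0 0 ^+ 2 + d * v 1 0 ^+ 2.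
Proof.
by rewrite -mulmxA [v in LHS]col2_eta diag2_col2 col2_dot; ring.
Qed.

Lemma posdef_diag2 a d : posdef (diag2 a d : 'M[R]_2) <-> 0 < a /\ 0 < d.
Proof.
split=> [[_ pd]|[a0 d0]].
- have pos (v : 'cV[R]_2) : v != 0 -> 0 < a * v 0 0 ^+ 2 + d * v 1 0 ^+ 2.
    by move=> v0; rewrite -quad_diag2 pd.
  split.
  + have /pos : (col2 1 0 : 'cV[R]_2) != 0.
      by apply/eqP=> /matrixP/(_ 0 0); rewrite !mxE /=; apply/eqP/oner_neq0.
    by rewrite !mxE /=; lra.
  + have /pos : (col2 0 1 : 'cV[R]_2) != 0.
      by apply/eqP=> /matrixP/(_ 1 0); rewrite !mxE /=; apply/eqP/oner_neq0.
    by rewrite !mxE /=; lra.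
- split=> [|v v0]; first exact: tr_diag2.
  have x0 : 0 <= a * v 0 0 ^+ 2 by rewrite mulr_ge0 ?sqr_ge0 ?ltW.
  have y0 : 0 <= d * v 1 0 ^+ 2 by rewrite mulr_ge0 ?sqr_ge0 ?ltW.
  rewrite quad_diag2 lt_def (addr_ge0 x0 y0) andbT.
  apply: contra v0; rewrite paddr_eq0 //.
  rewrite !mulf_eq0 (gt_eqF a0) (gt_eqF d0) /= !orbb => /andP[/eqP v00 /eqP v10].
  by apply/eqP/eq_col2; rewrite ?v00 ?v10 mxE.
Qed.

Lemma euclid_norm_col2 x y :
  euclid_norm (col2 x y : 'cV[R]_2) = Num.sqrt (x ^+ 2 + y ^+ 2).
Proof.
by rewrite /euclid_norm !(big_ord_recl, big_ord0) !mxE /= !addr0.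
Qed.

Lemma col2_00 : col2 0 0 = 0 :> 'cV[R]_2.
Proof. by apply: eq_col2; rewrite !mxE. Qed.

Lemma euclid_norm0 m n : euclid_norm (0 : 'M[R]_(m, n)) = 0.
Proof.
rewrite /euclid_norm big1 ?sqrtr0 // => i _.
by rewrite big1 // => j _; rewrite mxE expr0n.
Qed.

End PlaneDiagonal.

Section Counterexample.
Variable R : realType.
Implicit Type s : 'cV[R]_1.

Let A : 'M[R]_2 := diag2 1 (-1).
Let Q : 'M[R]_2 := diag2 4 4.
Let f : 'cV[R]_2 := col2 (Num.sqrt 27) 1.
Let b : 'cV[R]_2 := col2 0 0.
Let c : R := 52.
Let D : 'M[R]_2 := 2^-1 *: Q.
Let Q1 : 'I_1 -> 'M[R]_2 := fun=> Q.
Let b1 : 'I_1 -> 'cV[R]_2 := fun=> b.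
Let c1 : 'cV[R]_1 := const_mx c.

Let D_diag2 : D = diag2 2 2.
Proof. by rewrite /D /Q diag2Z; congr (diag2 _ _); field. Qed.

Let sqr_sqrt27 : Num.sqrt 27 ^+ 2 = 27 :> R.
Proof. by rewrite sqr_sqrtr. Qed.

Let G_diag2 s : G A Q1 s = diag2 (4 * s 0 0 + 1) (4 * s 0 0 - 1).
Proof.
rewrite /G big_ord1 /A /Q1 /Q diag2Z diag2D.
by congr (diag2 _ _); ring.
Qed.

Let F_const s : F f b1 s = f.
Proof. by rewrite /F big_ord1 /b1 /b col2_00 scaler0 subr0. Qed.

Let PdE s : 4 * s 0 0 + 1 != 0 -> 4 * s 0 0 - 1 != 0 ->
  Pd A f Q1 b1 c1 s =
  - (2^-1 * (27 / (4 * s 0 0 + 1) + (4 * s 0 0 - 1)^-1)) - 52 * s 0 0.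
Proof.
move=> p0 m0; rewrite /Pd F_const G_diag2 inv_diag2 // quad_diag2.
rewrite !mxE big_ord1 !mxE /= sqr_sqrt27 expr1n mulr1.
by rewrite [_^-1 * 27]mulrC.
Qed.

Lemma diag_data_D : posdef D /\ (D^T *m D = D ^+ 2 /\ D ^+ 2 = Q).
Proof.
have D2 : D *m D = Q.
  by rewrite D_diag2 diag2M; congr (diag2 _ _); ring.
split; first by rewrite D_diag2; apply/posdef_diag2; split; lra.
by rewrite expr2 -[D * D]/(D *m D) D2 {1}D_diag2 tr_diag2 -D_diag2.
Qed.

Lemma diag_data_C1 : condC1 A Q.
Proof. by rewrite /condC1 /A /Q diag2D; apply/posdef_diag2; split; lra. Qed.

Lemma diag_data_C2 : condC2 A Q D f b c.
Proof.
split; rewrite ?D_diag2.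
- by apply/posdef_diag2; split; lra.
- exact: diag_data_C1.
- by rewrite unit_diag2 ?oppr_eq0 ?oner_eq0.
- by rewrite unit_diag2 ?pnatr_eq0.
rewrite /b col2_00 trmx0 mul0mx euclid_norm0 add0r expr0n add0r.
rewrite /A inv_diag2 ?oppr_eq0 ?oner_eq0 //.
rewrite diag2M diag2_col2 euclid_norm_col2 !exprMn sqr_sqrt27 invr1 invrN1.
rewrite ger0_norm ?ler0n // /c ltr_sqrt; lra.
Qed.

(** On the positive definite side of the pole [1 / (u - 1)] contributes a loss,
    and [13 u + 27 / (2 (u + 1))] alone exceeds [29 / 2], because
    [26 u^2 - 3 u - 2] is positive for [1 < u]. *)
Lemma dual_value_lt_on_posdef s :
  posdef (G A Q1 s) -> Pd A f Q1 b1 c1 s < - (29 / 2).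
Proof.
rewrite G_diag2 => /posdef_diag2[p0 m0].
rewrite PdE ?gt_eqF //.
have mV : 0 < (4 * s 0 0 - 1)^-1 by rewrite invr_gt0.
have : 29 - 26 * (4 * s 0 0) < 27 / (4 * s 0 0 + 1).
  by rewrite ltr_pdivlMr //; nra.
lra.
Qed.

Let s_indef : 'cV[R]_1 := const_mx (1 / 8).

Let s_indef_neq0 :
  4 * s_indef 0 0 + 1 != 0 /\ 4 * s_indef 0 0 - 1 != 0.
Proof.
rewrite mxE; split; first by rewrite gt_eqF //; lra.
by rewrite lt_eqF //; lra.
Qed.

Lemma indef_dual_feasible : dualY A f Q1 b1 c1 s_indef.
Proof.
have [p0 m0] := s_indef_neq0.
split; first split=> [i|].
- by rewrite mxE; lra.
- by rewrite G_diag2 det_diag2 mulf_neq0.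
- move=> i; rewrite F_const G_diag2 inv_diag2 // diag2_col2 quad_diag2 col2_dot.
  rewrite !mxE /= !mul0r !addr0 exprMn sqr_sqrt27 mulr1 /c.
  (* [x = (2 sqrt 27 / 3, -2)], with [2 |x|^2 = 2 (12 + 4) = 32]. *)
  rewrite (_ : (4 * (1 / 8) + 1)^-1 = 2 / 3 :> R); last by field.
  rewrite (_ : (4 * (1 / 8) - 1)^-1 = - 2 :> R); last by field.
  lra.
Qed.

Lemma indef_dual_value : Pd A f Q1 b1 c1 s_indef = - (29 / 2).
Proof.
have [p0 m0] := s_indef_neq0.
by rewrite PdE // mxE; field.
Qed.

Lemma no_dual_solution_in_Splus :
  ~ (exists s, dual_solution A f Q1 b1 c1 s /\ dualSplus A Q1 s).
Proof.
move=> [s [[_ smax] [_ Gs_pd]]].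
have := smax _ indef_dual_feasible; rewrite indef_dual_value leNgt.
by rewrite dual_value_lt_on_posdef.
Qed.

End Counterexample.

Theorem mainTheorem2 (R : realType) :
  let A : 'M[R]_2 := mx_of_rows 2 2 [:: [:: 1; 0]; [:: 0; -1]] in
  let Q : 'M[R]_2 := mx_of_rows 2 2 [:: [:: 4; 0]; [:: 0; 4]] in
  let f : 'cV[R]_2 := mx_of_rows 2 1 [:: [:: Num.sqrt 27]; [:: 1]] in
  let b : 'cV[R]_2 := mx_of_rows 2 1 [:: [:: 0]; [:: 0]] in
  let c : R := 52 in
  let D : 'M[R]_2 := 2^-1 *: Q in
  let Q1 : 'I_1 -> 'M[R]_2 := fun=> Q in
  let b1 : 'I_1 -> 'cV[R]_2 := fun=> b in
  let c1 : 'cV[R]_1 := const_mx c in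
  [/\ posdef D /\ (D^T *m D = D ^+ 2 /\ D ^+ 2 = Q),
      condC1 A Q,
      condC2 A Q D f b c,
      ~ (exists s : 'cV[R]_1,
           dual_solution A f Q1 b1 c1 s /\ dualSplus A Q1 s) &
      ~ (condC1 A Q /\ condC2 A Q D f b c ->
         exists! s : 'cV[R]_1,
           [/\ s != 0, dual_solution A f Q1 b1 c1 s & dualSplus A Q1 s])].
Proof.
move=> A Q f b c D Q1 b1 c1.
have noS := @no_dual_solution_in_Splus R.
split=> //.
- exact: diag_data_D.
- exact: diag_data_C1.
- exact: diag_data_C2.
- move=> /(_ (conj (diag_data_C1 R) (diag_data_C2 R))) [s [[_ sol sS] _]].
  by apply: noS; exists s.
Qed.
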